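(* A bounded distance tariff satisfies the no-stopover property and the no-elongation property.
   Context: A PTN is a finite, simple, connected, undirected graph $(V,E)$, here with a positive physical length assigned to each edge. A path is a finite sequence $(x_1,\dots,x_n)$, $n\ge 1$, of (not necessarily distinct) nodes with consecutive nodes adjacent; $\mathcal{W}$ is the set of all paths; $l(W)$ is the sum of the edge lengths along $W$; $[x_i,x_j]$ denotes the subpath $(x_i,\dots,x_j)$. A fare structure is a function $p:\mathcal{W}\to\mathbb{R}_{\ge 0}$. A bounded distance tariff is the combination of a distance tariff with affine price function, $p_1(W)=f+\overline{p}_1\cdot l(W)$ with $f\ge 0$ and $\overline{p}_1>0$, and a flat tariff $p_2(W)=\overline{p}_2\ge 0$; i.e. $p(W)=\min\{f+\overline{p}_1\, l(W),\ \overline{p}_2\}$ for all $W\in\mathcal{W}$. No-stopover property: $p([x_1,x_n])\le p([x_1,x_i])+p([x_i,x_n])$ for all paths $(x_1,\dots,x_n)\in\mathcal{W}$, $n\ge 3$, and all $i\in\{2,\dots,n-1\}$. No-elongation property: $p([x_1,x_{n-1}])\le p([x_1,x_n])$ for all paths $(x_1,\dots,x_n)\in\mathcal{W}$, $n\ge 2$. *)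

(* Defs.v *)
From HB Require Import structures.
From mathcomp Require Import all_boot all_order all_algebra reals.

Set Implicit Arguments.
Unset Strict Implicit.
Unset Printing Implicit Defensive.

Import Order.TTheory GRing.Theory Num.Theory.
Local Open Scope ring_scope.

Definition adj (T : finType) (E : {set {set T}}) : rel T :=
  fun x y => [set x; y] \in E.

(* An edge is a 2-element set of nodes, so the graph is undirected, without
   loops and without parallel edges. *)
Record ptn := Ptn {
  node :> finType;
  edges : {set {set node}};
  edges_card2 : forall e, e \in edges -> #|e| = 2%N;
  ptn_connected : forall x y : node, connect (adj edges) x y
}.

Definition is_path (G : ptn) (s : seq G) : bool :=
  (s != [::]) && sorted (adj (edges G)) s.

Record ptn_path (G : ptn) := PtnPath {
  nodes :> seq G;
  nodesP : is_path nodes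
}.

HB.instance Definition _ (G : ptn) := [isSub for @nodes G].

(* [subpath W i j] is [x_i, x_j] for W = (x_1, ..., x_n), with 1-based indices.
   The default value W is only returned when 1 <= i <= j <= n fails. *)
Definition subpath (G : ptn) (W : ptn_path G) (i j : nat) : ptn_path G :=
  insubd W (drop i.-1 (take j W)).

Lemma subpathE (G : ptn) (W : ptn_path G) (i j : nat) :
  (1 <= i)%N -> (i <= j)%N -> (j <= size W)%N ->
  subpath W i j = drop i.-1 (take j W) :> seq G.
Proof.
move=> i1 ij jn; rewrite /subpath; apply: (@insubdK _ _ (ptn_path G)).
have /andP[_ sW] := nodesP W.
apply/andP; split; last by apply: drop_sorted; apply: take_sorted.
by rewrite -size_eq0 size_drop size_takel // subn_eq0 -ltnNge prednK.
Qed.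

Section Tariffs.
Variables (R : realType) (G : ptn).

(* Only the values of [len] on the edges of G are used; an edge traversed
   several times is counted each time. *)
Definition path_length (len : {set G} -> R) (W : ptn_path G) : R :=
  \sum_(xy <- zip W (behead W)) len [set xy.1; xy.2].

Record fare_structure := FareStructure {
  fare :> ptn_path G -> R;
  fare_ge0 : forall W, 0 <= fare W
}.

Definition affine_distance_tariff (len : {set G} -> R) (p : fare_structure) :=
  exists f pbar : R, [/\ 0 <= f, 0 < pbar &
    forall W, p W = f + pbar * path_length len W].

Definition flat_tariff (p : fare_structure) :=
  exists2 pbar : R, 0 <= pbar & forall W, p W = pbar.

Definition bounded_distance_tariff (len : {set G} -> R) (p : fare_structure) :=
  exists p1 p2 : fare_structure,
    [/\ affine_distance_tariff len p1, flat_tariff p2 &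
      forall W, p W = Num.min (p1 W) (p2 W)].

Definition no_stopover (p : fare_structure) :=
  forall (W : ptn_path G) (i : nat),
    let n := size W in
    (3 <= n)%N -> (2 <= i <= n.-1)%N ->
    p (subpath W 1 n) <= p (subpath W 1 i) + p (subpath W i n).

Definition no_elongation (p : fare_structure) :=
  forall W : ptn_path G,
    let n := size W in
    (2 <= n)%N -> p (subpath W 1 n.-1) <= p (subpath W 1 n).

End Tariffs.

(* Main.v *)
Require Import Defs.
From mathcomp Require Import all_boot all_order all_algebra reals.

(** Cutting a path at one of its nodes splits its edges between the two pieces,
    so the length is additive ([path_length_split]) and, the edge lengths being
    positive, the length of a path dominates that of its initial pieces; this
    gives no elongation, because the fare is a nondecreasing function of the
    length.

    For no stopover, compare the two partial fares. If one of them is the flat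
    price, their sum is already at least the flat price, fares being
    nonnegative. If both are affine, their sum is the affine price of the whole
    path plus one extra base fee [f >= 0]. Either way it is at least the
    minimum of the two prices of the whole path ([min_subadditive]). *)

Set Implicit Arguments.
Unset Strict Implicit.
Unset Printing Implicit Defensive.

Import Order.TTheory GRing.Theory Num.Theory.
Local Open Scope ring_scope.

(** The node at which the sequence is cut, at index [i.-1], belongs to both
    pieces, so that no consecutive pair is lost. *)
Lemma zip_behead_split (T : Type) (s : seq T) (i : nat) : (0 < i)%N ->
  zip s (behead s) = zip (take i s) (behead (take i s)) ++
                     zip (drop i.-1 s) (behead (drop i.-1 s)).
Proof.
case: i => // i _ /=.
elim: s i => [|x s IHs] [|i] //=; first by rewrite take0.
by case: s IHs => [|y s] IHs //=; rewrite (IHs i).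
Qed.

Lemma sorted_zip_behead (T : eqType) (e : rel T) (s : seq T) :
  sorted e s -> {in zip s (behead s), forall xy, e xy.1 xy.2}.
Proof.
elim: s => [|x [|y s] IHs] //= /andP[exy sorted_s] z.
by rewrite inE => /predU1P[->|/(IHs sorted_s)].
Qed.

Lemma min_subadditive (R : realDomainType) (f u v q : R) :
  0 <= f -> 0 <= u -> 0 <= v -> 0 <= q ->
  Num.min (f + (u + v)) q <= Num.min (f + u) q + Num.min (f + v) q.
Proof.
move=> f0 u0 v0 q0.
have min0 w : 0 <= w -> 0 <= Num.min (f + w) q.
  by move=> w0; rewrite le_min q0 addr_ge0.
have [le_fu|lt_qu] := leP (f + u) q; last first.
  by rewrite ge_min (lerDl q) min0 ?orbT.
have [le_fv|lt_qv] := leP (f + v) q; last first.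
  by rewrite ge_min (lerDr q) addr_ge0 ?orbT.
by rewrite ge_min addrA lerD2l lerDr f0.
Qed.

Section PathLength.
Variables (R : realType) (G : ptn) (len : {set G} -> R).

Lemma subpath_full (W : ptn_path G) : subpath W 1 (size W) = W.
Proof.
have W_gt0 : (0 < size W)%N.
  by have /andP[] := nodesP W; rewrite -size_eq0 lt0n.
by apply: val_inj; rewrite /= subpathE // take_size drop0.
Qed.

Lemma path_length_split (W : ptn_path G) (i : nat) :
  (0 < i <= size W)%N ->
  path_length len W =
    path_length len (subpath W 1 i) + path_length len (subpath W i (size W)).
Proof.
move=> /andP[i_gt0 le_iW]; rewrite /path_length !subpathE //.
by rewrite drop0 take_size -big_cat -zip_behead_split.
Qed.

Hypothesis len_ge0 : {in edges G, forall e, 0 <= len e}.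

Lemma path_length_ge0 (W : ptn_path G) : 0 <= path_length len W.
Proof.
have /andP[_ sorted_W] := nodesP W.
rewrite /path_length big_seq; apply: sumr_ge0 => xy /(sorted_zip_behead sorted_W).
exact: len_ge0.
Qed.

Lemma path_length_prefix_le (W : ptn_path G) (i : nat) :
  (0 < i <= size W)%N -> path_length len (subpath W 1 i) <= path_length len W.
Proof. by move=> /path_length_split ->; rewrite lerDl path_length_ge0. Qed.

End PathLength.

Theorem theorem51 (R : realType) (G : ptn) (len : {set G} -> R)
    (len_gt0 : forall e : {set G}, e \in edges G -> (0 < len e)%R)
    (p : fare_structure R G) :
  bounded_distance_tariff len p -> no_stopover p /\ no_elongation p.
Proof.
move=> [p1 [p2 [[f [a [f_ge0 a_gt0 p1E]]] [q q_ge0 p2E] pE]]].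
have len_ge0 : {in edges G, forall e, 0 <= len e}.
  by move=> e /len_gt0/ltW.
have fareE W : p W = Num.min (f + a * path_length len W) q.
  by rewrite pE p1E p2E.
split=> [W i n n_ge3 /andP[i_ge2 le_in]|W n n_ge2]; rewrite /n subpath_full.
  have i_in : (0 < i <= size W)%N.
    by rewrite (ltnW i_ge2) (leq_trans le_in) ?leq_pred.
  rewrite !fareE (path_length_split len i_in) mulrDr.
  by apply: min_subadditive; rewrite ?mulr_ge0 ?path_length_ge0 ?(ltW a_gt0).
have n1_in : (0 < n.-1 <= size W)%N by rewrite -subn1 subn_gt0 n_ge2 leq_subr.
rewrite !fareE; apply: le_min2 => //.
by rewrite lerD2l ler_pM2l // path_length_prefix_le.
Qed.
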